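(* Let $R$ be an integral domain whose group of divisibility satisfies $G(R)\cong_o L\circ A$, where $L$ is a linearly ordered group and $A$ is a trivially ordered group. Then $R$ is a pseudo-valuation domain (PVD).
   Context: For an integral domain $R$ with quotient field $QF(R)$ and unit group $U(R)$, the group of divisibility is $G(R)=(QF(R)\setminus\{0\})/U(R)$, partially ordered by $\alpha U(R)\le\beta U(R)$ iff there is $r\in R$ with $\alpha r=\beta$. For partially ordered groups, $\cong_o$ means that there is a group isomorphism $\phi$ such that both $\phi$ and $\phi^{-1}$ are order preserving. For abelian partially ordered groups $L,A$, the lexicographic sum $L\circ A$ is the group $L\oplus A$ with order $(l_1,a_1)\le(l_2,a_2)$ iff $l_1<l_2$, or $l_1=l_2$ and $a_1\le a_2$. Trivially ordered means $a\le b$ iff $a=b$ (an antichain). A prime ideal $I$ of $R$ is strongly prime if for all $a,b\in QF(R)$, $ab\in I$ implies $a\in I$ or $b\in I$. $R$ is a pseudo-valuation domain (PVD) if every prime ideal of $R$ is strongly prime. *)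

(* Defs.v *)
From HB Require Import structures.
From mathcomp Require Import all_boot all_order all_algebra.
From mathcomp Require Import boolp.

Set Implicit Arguments.
Unset Strict Implicit.
Unset Printing Implicit Defensive.

Import Order.TTheory GRing.Theory Num.Theory.
Local Open Scope ring_scope.
Local Open Scope quotient_scope.

Notation "x %:F" := (@FracField.tofrac _ x) : ring_scope.

(* [porderZmodType] does not relate the order to the addition; the mixin adds
   translation invariance. *)
HB.mixin Record isTranslationInvariant G of Num.POrderedZmodule G := {
  le_translate : forall z x y : G, x <= y -> z + x <= z + y
}.

#[short(type="poGroupType")]
HB.structure Definition POGroup :=
  { G of Num.POrderedZmodule G & isTranslationInvariant G }.

Definition linearly_ordered (G : poGroupType) : Prop :=
  forall x y : G, x <= y \/ y <= x.

Definition trivially_ordered (G : poGroupType) : Prop :=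
  forall x y : G, x <= y <-> x = y.

Definition order_isomorphic (G H : poGroupType) : Prop :=
  exists (phi : {additive G -> H}) (psi : H -> G),
    [/\ cancel phi psi, cancel psi phi,
        {homo phi : x y / x <= y} & {homo psi : x y / x <= y}].

Section LexSum.
Variables L A : poGroupType.

(* The alias carries the library's lexicographic order together with the
   componentwise addition of [L * A]; see [le_lexsum] for the order. *)
Definition lexsum : Type := L *lexi[ring_display] A.

HB.instance Definition _ := Order.POrder.on lexsum.
HB.instance Definition _ := GRing.Zmodule.copy lexsum (L * A)%type.

Lemma le_lexsum (x y : lexsum) :
  x <= y <-> x.1 < y.1 \/ x.1 = y.1 /\ x.2 <= y.2.
Proof.
rewrite [x <= y]/(_ && _) lt_neqAle; split.
  case/andP=> le1 /implyP le2; have [e1|n1] := eqVneq x.1 y.1.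
    by right; split=> //; apply: le2; rewrite e1.
  by left.
case=> [/andP[n1 le1]|[e1 le2]].
  rewrite le1; apply/implyP=> ge1.
  by case/eqP: n1; apply/le_anti; rewrite le1.
by rewrite e1 lexx le2.
Qed.

Lemma lexsum_le_translate (z x y : lexsum) : x <= y -> z + x <= z + y.
Proof.
move=> /le_lexsum H; apply/le_lexsum; rewrite /=; case: H => [lt1|[e1 le2]].
  left; rewrite lt_neqAle le_translate ?ltW // andbT.
  by rewrite (inj_eq (addrI _)) (lt_eqF lt1).
by right; rewrite e1; split=> //; apply: le_translate.
Qed.

HB.instance Definition _ :=
  isTranslationInvariant.Build lexsum lexsum_le_translate.

End LexSum.

(* The group of divisibility of R.  The law induced by multiplication is written
   additively, so that it is a [zmodType]. *)
Module DivGroup.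
Section DivGroup.
Variable R : idomainType.

Definition frac0 := {x : {fraction R} | x != 0}.

Definition assoc (x y : frac0) : bool :=
  `[< exists2 u : R, u \is a GRing.unit & val x * u%:F = val y >].

Lemma assoc_refl : reflexive assoc.
Proof. by move=> x; apply/asboolP; exists 1; rewrite ?unitr1 // rmorph1 mulr1. Qed.

Lemma assoc_sym_imp x y : assoc x y -> assoc y x.
Proof.
move=> /asboolP[u Uu e]; apply/asboolP; exists u^-1; first by rewrite unitrV.
by rewrite -e -mulrA -rmorphM mulrV // rmorph1 mulr1.
Qed.

Lemma assoc_sym : symmetric assoc.
Proof. by move=> x y; apply/idP/idP; apply: assoc_sym_imp. Qed.

Lemma assoc_trans : transitive assoc.
Proof.
move=> y x z /asboolP[u Uu e] /asboolP[v Uv f]; apply/asboolP.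
by exists (u * v); rewrite ?unitrM ?Uu // rmorphM mulrA e.
Qed.

Canonical assoc_equiv := EquivRel assoc assoc_refl assoc_sym assoc_trans.

Definition type := {eq_quot assoc}.

HB.instance Definition _ : EqQuotient _ assoc type := EqQuotient.on type.
HB.instance Definition _ := Choice.on type.

Definition one0 : frac0 := exist _ 1 (oner_neq0 _).
Definition mul0 (x y : frac0) : frac0 :=
  exist _ (val x * val y) (mulf_neq0 (valP x) (valP y)).
Definition inv0 (x : frac0) : frac0 :=
  exist _ (val x)^-1 (invr_neq0 (valP x)).

(* Computed on chosen representatives; [add_pi], [opp_pi] and [le_pi] give the
   values on arbitrary ones. *)
Definition zero : type := \pi_type one0.
Definition add (x y : type) : type := \pi_type (mul0 (repr x) (repr y)).
Definition opp (x : type) : type := \pi_type (inv0 (repr x)).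
Definition le (x y : type) : bool :=
  `[< exists r : R, val (repr x) * r%:F = val (repr y) >].

Lemma repr_pi (x : frac0) : assoc x (repr (\pi_type x)).
Proof. by have /eqmodP : x = repr (\pi_type x) %[mod type] by rewrite reprK. Qed.

Lemma pi_eqP (x y : frac0) : reflect (\pi_type x = \pi_type y) (assoc x y).
Proof. exact: eqmodP. Qed.

Lemma add_pi (x y : frac0) : add (\pi x) (\pi y) = \pi_type (mul0 x y).
Proof.
apply/esym/pi_eqP/asboolP.
have /asboolP[u Uu e] := repr_pi x; have /asboolP[v Uv f] := repr_pi y.
by exists (u * v); rewrite ?unitrM ?Uu //= rmorphM mulrACA e f.
Qed.

Lemma opp_pi (x : frac0) : opp (\pi x) = \pi_type (inv0 x).
Proof.
apply/esym/pi_eqP/asboolP; have /asboolP[u Uu e] := repr_pi x.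
exists u^-1; rewrite ?unitrV //= -e invfM; congr (_ * _).
by rewrite rmorphV.
Qed.

Lemma le_pi (x y : frac0) :
  le (\pi x) (\pi y) <-> exists r : R, val x * r%:F = val y.
Proof.
have /asboolP[u Uu e] := repr_pi x; have /asboolP[v Uv f] := repr_pi y.
split=> [/asboolP[r]|[r h]].
  rewrite -e -f => h; exists (u * r * v^-1).
  by rewrite !rmorphM /= !mulrA h -mulrA -rmorphM mulrV // rmorph1 mulr1.
apply/asboolP; exists (u^-1 * r * v).
rewrite -e -f -h -!mulrA -!rmorphM; congr (_ * _%:F).
by rewrite !mulrA mulrV // mul1r.
Qed.

Lemma addA : associative add.
Proof.
elim/quotW=> x; elim/quotW=> y; elim/quotW=> z; rewrite !add_pi.
by congr \pi; apply: val_inj; rewrite /= mulrA.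
Qed.

Lemma addC : commutative add.
Proof.
elim/quotW=> x; elim/quotW=> y; rewrite !add_pi.
by congr \pi; apply: val_inj; rewrite /= mulrC.
Qed.

Lemma add0 : left_id zero add.
Proof.
elim/quotW=> x; rewrite /zero add_pi.
by congr \pi; apply: val_inj; rewrite /= mul1r.
Qed.

Lemma addN : left_inverse zero opp add.
Proof.
elim/quotW=> x; rewrite opp_pi add_pi.
by congr \pi; apply: val_inj; rewrite /= mulVf // (valP x).
Qed.

HB.instance Definition _ := GRing.isZmodule.Build type addA addC add0 addN.

Lemma le_refl : reflexive le.
Proof. by elim/quotW=> x; apply/le_pi; exists 1; rewrite rmorph1 mulr1. Qed.

Lemma le_anti : antisymmetric le.
Proof.
elim/quotW=> x; elim/quotW=> y /andP[/le_pi[r e] /le_pi[s f]].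
apply/pi_eqP/asboolP; exists r => //; apply/unitrP; exists s.
suff rs : r * s = 1 by rewrite mulrC rs.
apply/eqP; rewrite -tofrac_eq rmorphM rmorph1; apply/eqP.
by apply: (mulfI (valP x)); rewrite mulrA e f mulr1.
Qed.

Lemma le_trans : transitive le.
Proof.
elim/quotW=> y; elim/quotW=> x; elim/quotW=> z /le_pi[r e] /le_pi[s f].
by apply/le_pi; exists (r * s); rewrite rmorphM mulrA e f.
Qed.

HB.instance Definition _ := Order.Le_isPOrder.Build ring_display type
  le_refl le_anti le_trans.

Lemma le_translate (z x y : type) : x <= y -> z + x <= z + y.
Proof.
elim/quotW: z => z; elim/quotW: x => x; elim/quotW: y => y /le_pi[r e].
suff: le (add (\pi_type z) (\pi_type x)) (add (\pi_type z) (\pi_type y)) by [].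
by rewrite !add_pi; apply/le_pi; exists r; rewrite /= -mulrA e.
Qed.

HB.instance Definition _ := isTranslationInvariant.Build type le_translate.

End DivGroup.
End DivGroup.
HB.export DivGroup.

Notation divgroup R := (DivGroup.type R).

Definition in_frac (R : idomainType) (I : {pred R}) (x : {fraction R}) : Prop :=
  exists2 r : R, r \in I & r%:F = x.

(* [prime_idealr] is the library's type of (proper) prime ideals; being stated
   with boolean predicates is no restriction, since [boolp] is assumed. *)
Definition strongly_prime (R : idomainType) (I : prime_idealr R) : Prop :=
  forall a b : {fraction R},
    in_frac I (a * b) -> in_frac I a \/ in_frac I b.

Definition pseudo_valuation_domain (R : idomainType) : Prop :=
  forall I : prime_idealr R, strongly_prime I.

(* Main.v *)
Require Import Defs.
From mathcomp Require Import all_boot all_order all_algebra.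
From mathcomp Require Import boolp.

(* Composing the isomorphism with the projection [lexsum L A -> L] gives a map
   [w] on nonzero fractions.  If [w x > 0] then [x] lies in [R]; since [A] is an
   antichain, nonzero nonunits [r] of [R] satisfy [w r > 0].  Let [a b]
   be a nonzero element of a prime ideal [I], so that [w (a b) > 0].  If
   [w a > 0] and [w b > 0], then [a] and [b] are in [R] and primality applies.
   If, say, [w a <= 0], then [w (b / a) >= w b > 0], so [b] and [b / a] are in
   [R], and [b ^ 2 = (a b) (b / a)] is in [I], hence so is [b]. *)

Import Order.TTheory GRing.Theory.
Local Open Scope ring_scope.
Local Open Scope quotient_scope.

Lemma pogroup_gt0_le (G : poGroupType) (x y : G) :
  0 < x + y -> x <= 0 -> 0 < y.
Proof.
move=> xy0 x0; apply: (lt_le_trans xy0).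
by rewrite addrC -[leRHS]addr0; apply: Defs.le_translate.
Qed.

(** If the first coordinate were zero, the second would be comparable to zero in an antichain, hence
    zero, so [x] would be zero. *)
Lemma lexsum_fst_gt0 (L A : poGroupType) (x : lexsum L A) :
  trivially_ordered A -> 0 < x -> 0 < x.1.
Proof.
move=> A_trivial; rewrite lt_neqAle => /andP[x0 /le_lexsum[//|[e1 /A_trivial e2]]].
by case/eqP: x0; case: x e1 e2 => x1 x2 /= <- <-.
Qed.

Lemma divgroup_valuation (R : idomainType) (L A : poGroupType) :
    trivially_ordered A -> order_isomorphic (divgroup R) (lexsum L A) ->
  exists w : {fraction R} -> L,
    [/\ forall x y, x != 0 -> y != 0 -> w (x * y) = w x + w y,
        forall x, x != 0 -> 0 < w x -> exists r : R, r%:F = x &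
        forall r : R, r != 0 -> r \isn't a GRing.unit -> 0 < w r%:F].
Proof.
move=> A_trivial [phi [psi [phiK psiK phi_homo psi_homo]]].
(* [insubd] makes [cls] total by giving the fraction [0] the class of [1]; this value is arbitrary,
   so every clause about [w] assumes nonzero arguments. *)
pose cls (x : {fraction R}) : divgroup R :=
  \pi_(divgroup R) (insubd (DivGroup.one0 R) x).
have clsE (x : {fraction R}) (x0 : x != 0) :
    cls x = \pi_(divgroup R) (exist _ x x0 : DivGroup.frac0 R).
  by congr \pi; apply: val_inj; rewrite val_insubd x0.
have zeroE : 0 = \pi_(divgroup R) (DivGroup.one0 R) by [].
exists (fun x => (phi (cls x)).1); split.
- move=> x y x0 y0; have xy0 : x * y != 0 by rewrite mulf_neq0.
  have -> : cls (x * y) = cls x + cls y.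
    rewrite !clsE; apply: esym; apply: etrans (DivGroup.add_pi _ _) _.
    by congr \pi; apply: val_inj.
  by rewrite raddfD.
- move=> x x0 w0; have : 0 <= phi (cls x) by apply/le_lexsum; left.
  (* Rewriting [0] as [phi 0] pulls the inequality back to [0 <= cls x]: the quotient of [x] by [1]
     lies in [R]. *)
  move=> /psi_homo; rewrite phiK -[X in psi X](raddf0 phi) phiK.
  rewrite clsE zeroE => /DivGroup.le_pi[r /=].
  by rewrite mul1r; exists r.
- move=> r r0 rU; have rF0 : r%:F != 0 by rewrite tofrac_eq0.
  apply: lexsum_fst_gt0 => //; rewrite lt_neqAle; apply/andP; split.
    (* By injectivity of [phi], a zero value would make [r] an associate of [1], hence a unit. *)
    rewrite -(raddf0 phi) (can_eq phiK) eq_sym clsE zeroE.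
    apply: contra rU => /eqP/esym/DivGroup.pi_eqP/asboolP[u Uu] /=.
    by rewrite mul1r => /eqP; rewrite tofrac_eq => /eqP <-.
  rewrite -(raddf0 phi); apply: phi_homo; rewrite clsE zeroE.
  by apply/DivGroup.le_pi; exists r; rewrite /= mul1r.
Qed.

Theorem theorem3p8 (R : idomainType) (L A : poGroupType)
    (L_linear : linearly_ordered L) (A_trivial : trivially_ordered A)
    (GR_iso : order_isomorphic (divgroup R) (lexsum L A)) :
  pseudo_valuation_domain R.
Proof.
have [w [wM w_gt0 w_nonunit]] := divgroup_valuation R L A A_trivial GR_iso.
have w_cases x : w x <= 0 \/ 0 < w x.
  have [w0|] := L_linear (w x) 0; first by left.
  by rewrite le_eqVlt => /predU1P[<-|w0]; [left | right].
move=> I a b abI.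
have in0 : in_frac I 0 by exists 0; rewrite ?rmorph0 // rpred0.
have [->|a0] := eqVneq a 0; first by left.
have [->|b0] := eqVneq b 0; first by right.
have wab : 0 < w (a * b).
  case: abI => r rI er; rewrite -er; apply: w_nonunit.
    by rewrite -(tofrac_eq0 r) er mulf_neq0.
  (* A unit in [I] would put [1] in the proper ideal [I]. *)
  apply/negP => rU; have := idealr1 I; rewrite -(mulVr rU).
  by rewrite (idealMr r^-1 rI).
have half (x y : {fraction R}) : x != 0 -> y != 0 -> in_frac I (x * y) ->
    0 < w (x * y) -> w x <= 0 -> in_frac I y.
  move=> x0 y0 [r rI er]; rewrite wM // => wxy wx.
  have wy := pogroup_gt0_le _ _ _ wxy wx.
  have yx0 : y / x != 0 by rewrite mulf_neq0 ?invr_eq0.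
  have [s es] := w_gt0 y y0 wy.
  have [t et] : exists t : R, t%:F = y / x.
    (* Here [w x + w (y / x) = w y] is positive while [w x <= 0]. *)
    apply: w_gt0 => //; apply: pogroup_gt0_le wx.
    by rewrite -wM // mulrC divfK.
  have sI : s * s \in I.
    have -> : s * s = t * r.
      by apply/eqP; rewrite -tofrac_eq !rmorphM /= es et er mulrA divfK.
    exact: idealMr.
  by exists s => //; rewrite prime_idealrM orbb in sI.
have [wa|wa] := w_cases a; first by right; apply: half abI wab wa.
have [wb|wb] := w_cases b; first by left; apply: (half b a); rewrite // mulrC.
have [r er] := w_gt0 a a0 wa; have [s es] := w_gt0 b b0 wb.
have rsI : r * s \in I.
  case: abI => t tI; rewrite -er -es -rmorphM => /eqP.
  by rewrite tofrac_eq => /eqP <-.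
by move: rsI; rewrite prime_idealrM => /orP[]; [left; exists r | right; exists s].
Qed.
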